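(* Let $X$ be a metric space and let $E,F\subset X$. Then $$\dim_{ML}(E\cup F)=\max\{\dim_{ML}E,\ \dim_{ML}F\}.$$
   Context: Subsets of a metric space are regarded as metric spaces with the inherited metric. For a metric space $(X,\rho)$, $B(x,r)=\{y\in X:\rho(x,y)\le r\}$ denotes the closed ball in $X$, and $N_r(A)\in\{0,1,2,\dots\}\cup\{\infty\}$ denotes the minimal number of sets of diameter at most $r$ required to cover $A\subset X$. The lower dimension of a metric space $X$ with at least two points is $$\dim_L X=\sup\Big\{\alpha\in\mathbb{R}:\ \exists\, C>0 \text{ such that for all real } 0<r<R\le\operatorname{diam}X \text{ and all } x\in X,\ N_r(B(x,R))\ge C\left(\tfrac{R}{r}\right)^{\alpha}\Big\}\in[0,\infty],$$ where $\operatorname{diam}X$ may be $\infty$. Conventions: $\dim_L\emptyset=0$, and $\dim_L X=0$ if $X$ is a one-point space. The modified lower dimension of a metric space $X$ is $\dim_{ML}X=\sup\{\dim_L E: E\subset X\}$. *)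

(* Defs.v *)
From mathcomp Require Import all_boot all_order all_algebra.
From mathcomp Require Import all_classical all_reals all_analysis.

Set Implicit Arguments.
Unset Strict Implicit.
Unset Printing Implicit Defensive.

Import Order.TTheory GRing.Theory Num.Theory.

Local Open Scope classical_set_scope.
Local Open Scope ring_scope.
Local Open Scope ereal_scope.

(* A metric subspace is represented by its underlying set E : set X; all notions
   below are relative to E, with the metric [mdist] inherited from X. *)
Section lower_dimension.
Context {R : realType} {X : metricType R}.
Implicit Types (E A : set X).

(* The diameter of the empty set is -oo, hence below every r. *)
Definition diam A : \bar R := ereal_sup [set (mdist x y)%:E | x in A & y in A].

Definition cball_in E (x : X) (r : R) : set X :=
  [set y | E y /\ (mdist x y <= r)%R].

Definition covers_by E (r : R) A (n : nat) : Prop :=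
  exists U : 'I_n -> set X,
    (forall i, U i `<=` E /\ diam (U i) <= r%:E) /\ A `<=` \bigcup_i U i.

(* N_r(A) in the metric space E; it is +oo when no finite cover exists. *)
Definition cover_number E (r : R) A : \bar R :=
  ereal_inf [set n%:R%:E | n in covers_by E r A].

Definition lower_exponent E (a : R) : Prop :=
  exists2 C : R, (0 < C)%R &
    forall r s : R, (0 < r)%R -> (r < s)%R -> s%:E <= diam E ->
    forall x : X, E x ->
      (C * (s / r) `^ a)%:E <= cover_number E r (cball_in E x s).

Definition at_least_two_points E : Prop :=
  exists x y : X, [/\ E x, E y & x <> y].

(* On the empty set and on one-point sets [lower_exponent] holds vacuously for
   every exponent, so the value 0 has to be imposed there. *)
Definition dimL E : \bar R :=
  if `[< at_least_two_points E >]
  then ereal_sup [set a%:E | a in lower_exponent E]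
  else 0.

Definition dimML E : \bar R := ereal_sup [set dimL A | A in [set A | A `<=` E]].

End lower_dimension.

(* Main.v *)
(* If A is contained in the union of E and F, then either A `&` E is dense in A
   and inherits its lower dimension, or some ball of A lies in F. Every ball of
   A contains a set that is at least as large in lower dimension as A. *)
Require Import Defs.
From mathcomp Require Import all_boot all_order all_algebra.
From mathcomp Require Import all_classical all_reals all_analysis.
From mathcomp Require Import ring lra.

Local Open Scope classical_set_scope.

Import Order.TTheory GRing.Theory Num.Theory.

Section lower_exponents.
Set Implicit Arguments.
Unset Strict Implicit.
Context {R : realType} {X : metricType R}.
Implicit Types (A Y U : set X) (a r s K : R) (x y z : X).
Local Open Scope ring_scope.

(** * Covering numbers and the transfer of lower exponents *)

Lemma diam_leP A r :
  (diam A <= r%:E)%E <-> forall x y, A x -> A y -> mdist x y <= r.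
Proof.
split=> [dA x y Ax Ay|dA].
  rewrite -lee_fin; apply: le_trans dA; apply: ereal_sup_ubound.
  by exists x => //; exists y.
by apply: ge_ereal_sup => _ [x Ax [y Ay <-]]; rewrite lee_fin; exact: dA.
Qed.

Lemma mdist_diam A x y : A x -> A y -> ((mdist x y)%:E <= diam A)%E.
Proof. by move=> Ax Ay; apply: ereal_sup_ubound; exists x => //; exists y. Qed.

Lemma diamS A Y : Y `<=` A -> (diam Y <= diam A)%E.
Proof.
move=> YA; apply: ge_ereal_sup => _ [x Yx [y Yy <-]].
by apply: mdist_diam; exact: YA.
Qed.

Lemma cover_number_geP Y r A s :
  (s%:E <= cover_number Y r A)%E <->
  forall n, covers_by Y r A n -> s <= n%:R.
Proof.
split=> [sA n nA|sA].
  by rewrite -lee_fin; apply: le_trans sA _; apply: ereal_inf_lbound; exists n.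
by apply: le_ereal_inf_tmp => _ [n nA <-]; rewrite lee_fin; exact: sA.
Qed.

(* Thickening each set of a cover of a ball of [Y] by [r] yields a cover of
   the ball of [A] by sets of diameter at most [3 * r]. *)
Lemma lower_exponent_transfer A Y K a : 3 <= K -> 0 <= a -> Y `<=` A ->
  (forall x s, Y x -> 0 < s -> (s%:E <= diam Y)%E ->
    exists2 z, A z & cball_in A z (s / K) `<=` closure (cball_in Y x s)) ->
  lower_exponent A a -> lower_exponent Y a.
Proof.
move=> K3 a0 YA YK [C C0 AC].
have K0 : 0 < K by lra.
have c0 : 0 < (K^-1 / K) `^ a by rewrite powR_gt0// divr_gt0// invr_gt0.
(* The power turns [s / r] into the ratio of the scales [s / K] and [K * r] at which [A] is
   examined. The minimum with 1 serves the case where these scales are out of order. *)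
exists (Num.min C 1 * (K^-1 / K) `^ a).
  by rewrite mulr_gt0// lt_min C0 ltr01.
move=> r s r0 rs sY x Yx; have s0 : 0 < s := lt_trans r0 rs.
have Kr0 : 0 < K * r by rewrite mulr_gt0.
have sK0 : 0 < s / K by rewrite divr_gt0.
apply/cover_number_geP => n [U [UY Ucov]].
rewrite -mulrA -powRM; last 2 first.
- by rewrite ltW// divr_gt0// invr_gt0.
- by rewrite ltW// divr_gt0.
have -> : K^-1 / K * (s / r) = (s / K) / (K * r).
  by field; rewrite !gt_eqF.
set t := (_ / (K * r)).
have t0 : 0 <= t by rewrite divr_ge0// ltW.
have [Krs|Krs] := ltP (K * r) (s / K).
  apply: (@le_trans _ _ (C * t `^ a)).
    by rewrite ler_wpM2r ?powR_ge0// ge_min lexx.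
  have [z Az zY] := YK x s Yx s0 sY.
  have sA : ((s / K)%:E <= diam A)%E.
    apply: le_trans (diamS YA); apply: le_trans sY.
    by rewrite lee_fin ler_pdivrMr// ler_peMr ?ltW//; lra.
  have /cover_number_geP := AC _ _ Kr0 Krs sA z Az; apply.
  exists (fun i => [set y | A y /\ exists2 u, U i u & mdist y u <= r]); split.
    move=> i; split=> [y []//|]; apply/diam_leP => y y' [_ [u Uu yu]] [_ [u' Uu' yu']].
    have /diam_leP/(_ _ _ Uu Uu') uu' := (UY i).2.
    have h1 := metric_triangle y u y'.
    have h2 := metric_triangle u u' y'.
    rewrite (metric_sym u') in h2.
    apply: (@le_trans _ _ (3 * r)); first by lra.
    by rewrite ler_pM2r.
  move=> y yz; have [u [/Ucov[i _ Uu] yu]] := zY y yz _ (nbhsx_ballx _ _ r0).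
  rewrite ballEmdist/= in yu.
  by exists i => //; split; [exact: yz.1 | exists u => //; exact: ltW].
(* The required bound is now at most 1, so it suffices that the cover is nonempty. *)
have t1 : t <= 1 by rewrite ler_pdivrMr// mul1r.
have [i _ _] : (\bigcup_i U i) x.
  by apply: Ucov; split => //; rewrite mdistxx ltW.
apply: (@le_trans _ _ 1); last by rewrite ler1n (leq_trans _ (ltn_ord i)).
apply: mulr_ile1; rewrite ?powR_ge0//.
- by rewrite le_min ler01 ltW.
- by rewrite ge_min lexx orbT.
by have := ge0_ler_powR a0 t0 ler01 t1; rewrite powR1.
Qed.

(** A point of [A] within [s / 3] of [x] is a limit of points of [Y], eventually within [2 * s / 3]
    of [x]. *)
Lemma lower_exponent_dense A Y a : 0 <= a -> Y `<=` A -> A `<=` closure Y ->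
  lower_exponent A a -> lower_exponent Y a.
Proof.
move=> a0 YA AY; apply: (@lower_exponent_transfer _ _ 3) => // x s Yx s0 _.
exists x; first exact: YA.
move=> y [Ay xy] B By.
have s30 : 0 < s / 3 by lra.
have [|u [Yu [Bu yu]]] := AY y Ay (B `&` ball y (s / 3)).
  by apply: filterI => //; exact: nbhsx_ballx.
exists u; split=> //; split=> //.
rewrite ballEmdist/= in yu.
by have := metric_triangle x y u; lra.
Qed.

(** * Localising a lower exponent to a ball *)

(** The first jump has length at most [s / 4] and the bounds halve, so that chains stay within
    [s / 2] of [x]. *)
Fixpoint ball_chain A x s k : set X :=
  if k is k'.+1 then
    \bigcup_(y in ball_chain A x s k') cball_in A y (s / 2 ^+ k'.+2)
  else [set x].

Lemma ball_chain_sub A x s k : A x -> ball_chain A x s k `<=` A.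
Proof. by move=> Ax; case: k => [_ ->//|k] y [z _ []]. Qed.

(** The bound is the geometric sum of the jump radii [s / 2 ^+ j.+1] for [k < j <= m]. *)
Lemma ball_chain_ancestor A x s m k y : (k <= m)%N -> ball_chain A x s m y ->
  exists2 z, ball_chain A x s k z & mdist z y <= s / 2 ^+ k.+1 - s / 2 ^+ m.+1.
Proof.
elim: m y => [|m IH] y.
  by rewrite leqn0 => /eqP-> ->; exists x => //; rewrite mdistxx subrr.
rewrite leq_eqVlt => /orP[/eqP->|km].
  by exists y => //; rewrite mdistxx subrr.
move=> [y' my' [Ay yy']]; have [z kz zy'] := IH y' km my'.
exists z => //; have := metric_triangle z y' y.
move: zy' yy'; rewrite (exprS _ m.+1) invfM mulrCA; lra.
Qed.

(** A chain may be prolonged by jumps of length zero. *)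
Lemma ball_chain_homo A x s m k : A x -> 0 <= s -> (k <= m)%N ->
  ball_chain A x s k `<=` ball_chain A x s m.
Proof.
move=> Ax s0 /subnK <-; elim: (m - k)%N => [//|d IH] y /IH dy.
exists y => //; split; first exact: ball_chain_sub dy.
by rewrite mdistxx divr_ge0// exprn_ge0.
Qed.

(* A ball of [A] need not inherit the exponent of [A], since balls centred near
   its boundary may be cut off. The union of the chains does: a point within
   distance [s / 2 ^+ k.+1] of the [k]-th generation has a full ball of [A] of
   radius [s / 2 ^+ k.+2] nearby. *)
Lemma lower_exponent_local A x s a : 0 < s -> 0 <= a -> A x ->
  lower_exponent A a ->
  exists Y, [/\ Y `<=` cball_in A x s, cball_in A x (s / 4) `<=` Y &
                lower_exponent Y a].
Proof.
move=> s0 a0 Ax Aa.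
pose Y := \bigcup_k ball_chain A x s k.
have Yball y : Y y -> mdist x y <= s / 2.
  move=> [m _ my]; have [_ -> xy] := ball_chain_ancestor (leq0n m) my.
  have : 0 <= s / 2 ^+ m.+1 by rewrite divr_ge0// ltW// exprn_gt0.
  by rewrite expr1 in xy; lra.
have YA : Y `<=` A by move=> y [k _]; exact: ball_chain_sub.
exists Y; split.
- by move=> y Yy; split; [exact: YA | have := Yball y Yy; lra].
- move=> y xy; exists 1%N => //; exists x => //=.
  by rewrite (_ : 2 ^+ 2 = 4 :> R)// expr2; lra.
(* If [s / 2 ^+ k <= t <= s / 2 ^+ k * 2], then [t / 8] is at most [s / 2 ^+ k.+2], the radius of
   the ball in [Y] around a point [z] of generation [k]. An ancestor [z] of [y] lies within [t / 2]
   of [y], so the ball of radius [t / 8] around [z] stays within [t] of [y]. *)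
apply: (@lower_exponent_transfer A _ 8) => //; first by lra.
move=> y t Yy t0 tY.
have ts : t <= s.
  rewrite -lee_fin; apply: le_trans tY _; apply/diam_leP => u v Yu Yv.
  have := metric_triangle u x v; rewrite (metric_sym u x).
  by have := Yball u Yu; have := Yball v Yv; lra.
have [k [kt tk]] : exists k, s / 2 ^+ k <= t /\ t <= s / 2 ^+ k * 2.
  have ex : exists k, s / 2 ^+ k <= t.
    have [n _ /(_ n (leqnn n))] := near_infty_natSinv_expn_lt (PosNum (divr_gt0 t0 s0)).
    rewrite /= => nt; exists n; rewrite mulrC -ler_pdivlMr// -div1r.
    by rewrite ltW.
  exists (ex_minn ex); case: ex_minnP => k kt kmin; split => //.
  (* Minimality says nothing when [k = 0]; there [t <= s] gives the upper bound. *)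
  case: k kt kmin => [_ _|k _ kmin]; first by rewrite expr0 divr1; lra.
  have : ~~ (s / 2 ^+ k <= t) by apply/negP => /kmin; rewrite ltnn.
  rewrite -ltNge exprS invfM mulrCA; lra.
have [z kz [zy kzY]] : exists2 z, A z & mdist z y <= s / 2 ^+ k.+1 /\
    cball_in A z (s / 2 ^+ k.+2) `<=` Y.
  have kY u : ball_chain A x s k u -> cball_in A u (s / 2 ^+ k.+2) `<=` Y.
    by move=> ku v uv; exists k.+1 => //; exists u.
  case: Yy => m _ my.
  (* The generation of [y] is raised to at least [k], so that an ancestor in generation [k] exists
     even if [m < k]. *)
  have := ball_chain_homo Ax (ltW s0) (leq_maxl m k) my.
  move=> /(ball_chain_ancestor (leq_maxr m k))[z kz zy].
  exists z; first exact: ball_chain_sub kz.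
  split; last exact: kY.
  apply: le_trans zy _.
  by rewrite gerBl divr_ge0// ltW// exprn_gt0.
exists z => // u [Au zu]; apply: subset_closure.
have e1 : s / 2 ^+ k.+1 = s / 2 ^+ k / 2.
  by rewrite exprS invfM mulrCA mulrC.
have e2 : s / 2 ^+ k.+2 = s / 2 ^+ k / 4.
  rewrite 2!exprS; field.
  by rewrite expf_neq0.
rewrite e1 in zy; rewrite e2 in kzY.
split; first by apply: kzY; split => //; lra.
by have := metric_triangle y z u; rewrite (metric_sym y z); lra.
Qed.

Lemma lower_exponent_not_isolated A x s a : 0 < a -> lower_exponent A a ->
  at_least_two_points A -> A x -> 0 < s -> exists y, cball_in A x s y /\ x <> y.
Proof.
move=> a0 [C C0 AC] [p [q [Ap Aq pq]]] Ax s0.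
have d0 : 0 < mdist p q by rewrite mdist_gt0; apply/eqP.
pose t := Num.min s (mdist p q).
have t0 : 0 < t by rewrite lt_min s0.
have ts : t <= s by rewrite ge_min lexx.
have tA : (t%:E <= diam A)%E.
  by apply: le_trans (mdist_diam Ap Aq); rewrite lee_fin ge_min lexx orbT.
apply: contrapT => nex.
have xx y : cball_in A x t y -> y = x.
  move=> [Ay xy]; apply: contrapT => yx; apply: nex; exists y.
  by split; [split => //; exact: le_trans ts|exact/nesym].
pose v := (2 / C) `^ a^-1 + 1.
have v1 : 1 < v by rewrite ltrDr powR_gt0// divr_gt0.
have v0 : 0 < v by lra.
have r0 : 0 < t / v by rewrite divr_gt0.
have rt : t / v < t by rewrite ltr_pdivrMr// ltr_pMr.
have /cover_number_geP/(_ 1%N) := AC _ _ r0 rt tA x Ax.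
have -> : t / (t / v) = v by field; rewrite !gt_eqF.
have : 2 / C <= v `^ a.
  have <- : ((2 / C) `^ a^-1) `^ a = 2 / C.
    by rewrite -powRrM mulVf ?gt_eqF// powRr1// ltW// divr_gt0.
  by apply: ge0_ler_powR; rewrite ?nnegrE ?powR_ge0 ?lerDl//; apply: ltW.
rewrite ler_pdivrMr// mulrC => C2 cov1.
suff : covers_by A (t / v) (cball_in A x t) 1 by move/cov1; lra.
exists (fun=> [set x]); split=> [_|y /xx ->]; last by exists ord0.
split=> [_ ->//|]; apply/diam_leP => _ _ -> ->.
by rewrite mdistxx ltW.
Qed.

(** * From exponents to the modified lower dimension *)

Lemma dimL_ge A a : at_least_two_points A -> lower_exponent A a ->
  (a%:E <= dimL A)%E.
Proof.
move=> A2 Aa; rewrite /dimL; case: asboolP => // _.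
by apply: ereal_sup_ubound; exists a.
Qed.

Lemma dimL_le_dimML A Y : Y `<=` A -> (dimL Y <= dimML A)%E.
Proof. by move=> YA; apply: ereal_sup_ubound; exists Y. Qed.

Lemma dimML_ge0 A : (0 <= dimML A)%E.
Proof.
suff <- : @dimL R X set0 = 0%E by apply: dimL_le_dimML.
by rewrite /dimL; case: asboolP => // -[x [y []]].
Qed.

Lemma dimMLS A Y : Y `<=` A -> (dimML Y <= dimML A)%E.
Proof.
move=> YA; apply: ge_ereal_sup => _ [B BY <-].
by apply: dimL_le_dimML; exact: subset_trans YA.
Qed.

Lemma at_least_two_points_dense A Y : A `<=` closure Y ->
  at_least_two_points A -> at_least_two_points Y.
Proof.
move=> AY [p [q [Ap Aq pq]]].
have d0 : 0 < mdist p q / 2 by rewrite divr_gt0// mdist_gt0; apply/eqP.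
have [u [Yu pu]] := AY p Ap _ (nbhsx_ballx _ _ d0).
have [v [Yv qv]] := AY q Aq _ (nbhsx_ballx _ _ d0).
rewrite !ballEmdist/= in pu qv.
exists u, v; split => // uv; subst v.
by have := metric_triangle p u q; rewrite (metric_sym u); lra.
Qed.

Lemma dimL_le_maxdimML A E F : A `<=` E `|` F ->
  (dimL A <= maxe (dimML E) (dimML F))%E.
Proof.
move=> AEF.
have max0 : (0 <= maxe (dimML E) (dimML F))%E by rewrite le_max dimML_ge0.
rewrite /dimL; case: asboolP => [A2|//].
apply: ge_ereal_sup => _ [a Aa <-].
have [a0|a0] := leP a 0; first by apply: le_trans max0; rewrite lee_fin.
rewrite le_max; apply/orP.
have [dense|/existsNP[x /not_implyP[Ax /existsNP[B /not_implyP[xB EB]]]]] :=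
  pselect (A `<=` closure (A `&` E)).
  left; apply: le_trans (dimL_le_dimML (@subIsetr _ A E)).
  apply: dimL_ge; first exact: at_least_two_points_dense A2.
  by apply: lower_exponent_dense Aa => //; exact: ltW.
right; move/nbhs_ballP: xB => [e /= e0 eB].
have e20 : 0 < e / 2 by lra.
(* Halving [e] puts the closed ball that contains [Y] inside the open ball that misses [A] [&]
   [E]. *)
have [Y [Ye eY Ya]] := lower_exponent_local e20 (ltW a0) Ax Aa.
have e80 : 0 < e / 2 / 4 by lra.
(* A second point of [Y] keeps [dimL Y] from being 0 by convention. *)
have [y [xy nxy]] := lower_exponent_not_isolated a0 Aa A2 Ax e80.
have YF : Y `<=` F; last first.
  apply: le_trans (dimL_le_dimML YF); apply: dimL_ge Ya.
  exists x, y; split=> //; apply: eY => //.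
  by split => //; rewrite mdistxx ltW.
move=> z /Ye[Az xz]; have [Ez|//] := AEF z Az.
exfalso; apply: EB; exists z; split => //.
by apply: eB; rewrite ballEmdist/=; lra.
Qed.

End lower_exponents.

Theorem theorem2p2 (R : realType) (X : metricType R) (E F : set X) :
  dimML (E `|` F) = maxe (dimML E) (dimML F).
Proof.
apply/eqP; rewrite eq_le ge_max; apply/and3P; split.
- by apply: ge_ereal_sup => _ [A AEF <-]; exact: dimL_le_maxdimML.
- exact/dimMLS/subsetUl.
- exact/dimMLS/subsetUr.
Qed.
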